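(* Let $K$ be a field of characteristic zero and let $n$ and $p$ be positive integers. If $k\geq np-n+1$ is an even integer, then the relatively free algebra $F_n(\mathfrak{N}_p)$ satisfies the polynomial identity $[x_1,x_2][x_3,x_4]\cdots[x_{k-1},x_k]=0$.
   Context: All algebras are associative and unitary over a field $K$ of characteristic zero. $K\langle X\rangle$ is the free unitary associative algebra on $X=\{x_1,x_2,\dots\}$. Commutators are left-normed: $[a,b]=ab-ba$ and $[a_1,\dots,a_{m}]=[[a_1,\dots,a_{m-1}],a_m]$ for $m\ge 3$. $I_p$ is the two-sided ideal of $K\langle X\rangle$ generated by all commutators $[u_1,\dots,u_p]$, $u_i\in K\langle X\rangle$. $\mathfrak{N}_p$ is the variety of algebras satisfying $[x_1,\dots,x_{p+1}]=0$, and $F_n(\mathfrak{N}_p)=K\langle x_1,\dots,x_n\rangle/(I_{p+1}\cap K\langle x_1,\dots,x_n\rangle)$. An algebra $A$ satisfies the identity $f(x_1,\dots,x_m)=0$ if $f(a_1,\dots,a_m)=0$ for all $a_i\in A$. *)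

(* Defs.v *)
From HB Require Import structures.
From mathcomp Require Import all_boot all_algebra.
From mathcomp Require Import finmap monalg.
From mathcomp Require Import boolp classical_sets.

Set Implicit Arguments.
Unset Strict Implicit.
Unset Printing Implicit Defensive.

Import GRing.Theory.

Local Open Scope classical_set_scope.
Local Open Scope ring_scope.
Local Open Scope quotient_scope.

(* K<X> is the monoid algebra of the free monoid on X = {x_1, x_2, ...};
   the letter i : nat stands for x_{i+1}. *)
Definition freeAlg (K : fieldType) := {malg K[{fmonom nat}]}.

HB.instance Definition _ (K : fieldType) := GRing.Lalgebra.on (freeAlg K).

Section FreeAlg.
Variable K : fieldType.

Fact freeAlg_scaleAr (c : K) (f g : {malg K[{fmonom nat}]}) :
  c *: (f * g) = f * (c *: g).
Proof.
apply/malgP=> m; rewrite mcoeffZ mcoeffMl mulr_sumr.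
rewrite (@mcoeffMlw _ _ (msupp f) (msupp g)) //; last exact: msuppZ_le.
apply: eq_bigr => k1 _; rewrite mulr_sumr; apply: eq_bigr => k2 _.
by rewrite mcoeffZ mulrnAr mulrCA.
Qed.

HB.instance Definition _ :=
  GRing.Lalgebra_isAlgebra.Build K (freeAlg K) freeAlg_scaleAr.

Definition fvar (i : nat) : freeAlg K := << fmu i >>.

(* f(a_1, a_2, ...), where a i is substituted for x_{i+1} *)
Definition feval (A : algType K) (a : nat -> A) (f : freeAlg K) : A :=
  \sum_(m <- msupp f) f@_m *: \prod_(i <- (m : seq nat)) a i.

Definition satisfies_identity (A : algType K) (f : freeAlg K) : Prop :=
  forall a : nat -> A, feval a f = 0.

End FreeAlg.

Definition comm (R : pzRingType) (a b : R) : R := a * b - b * a.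

(* the left-normed commutator [u_1, ..., u_p] of s = [:: u_1; ...; u_p] *)
Definition lcomm (R : pzRingType) (s : seq R) : R :=
  foldl (@comm R) (head 0 s) (behead s).

Definition two_sided_ideal (R : pzRingType) (I : set R) : Prop :=
  [/\ I 0, forall x y, I x -> I y -> I (x - y)
    & forall a x, I x -> I (a * x) /\ I (x * a)].

Definition ideal_gen (R : pzRingType) (S : set R) : set R :=
  smallest (@two_sided_ideal R) S.

Lemma ideal_gen_ideal (R : pzRingType) (S : set R) :
  two_sided_ideal (ideal_gen S).
Proof.
split=> [J [[]] //|x y Ix Iy J JS|a x Ix].
- by case: (JS) => -[_ JB _] _; apply: JB; [apply: Ix|apply: Iy].
- by split=> J JS; case: (JS) => -[_ _ JM] _; have [] := JM a x (Ix J JS).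
Qed.

(* I_p, for p >= 1 *)
Definition comm_ideal (K : fieldType) (p : nat) : set (freeAlg K) :=
  ideal_gen [set f | exists u : p.-tuple (freeAlg K), f = lcomm u].

(* Quotient of a K-algebra by a proper two-sided ideal; properness is needed
   because algType only covers nonzero algebras. *)
Record properIdeal (R : pzRingType) := ProperIdeal {
  ideal_carrier : set R;
  ideal_carrierP : two_sided_ideal ideal_carrier;
  ideal_proper : ~ ideal_carrier 1 }.

Definition ideal_pred (R : pzRingType) (I : properIdeal R) : {pred R} :=
  fun x => `[< ideal_carrier I x >].

Section IdealPred.
Variables (R : pzRingType) (I : properIdeal R).

Fact ideal_predE x : (x \in ideal_pred I) = `[< ideal_carrier I x >].
Proof. by []. Qed.

Fact ideal_pred_zmod_closed : zmod_closed (ideal_pred I).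
Proof.
have [I0 IB _] := ideal_carrierP I.
split=> [|x y]; first exact/asboolP.
by move=> /asboolP Ix /asboolP Iy; apply/asboolP/IB.
Qed.

HB.instance Definition _ :=
  GRing.isZmodClosed.Build R (ideal_pred I) ideal_pred_zmod_closed.

Fact ideal_predMl a x : x \in ideal_pred I -> a * x \in ideal_pred I.
Proof.
have [_ _ IM] := ideal_carrierP I.
by move=> /asboolP /(IM a) [] *; apply/asboolP.
Qed.

Fact ideal_predMr a x : x \in ideal_pred I -> x * a \in ideal_pred I.
Proof.
have [_ _ IM] := ideal_carrierP I.
by move=> /asboolP /(IM a) [] *; apply/asboolP.
Qed.

End IdealPred.

Definition quotAlg (K : fieldType) (A : algType K) (I : properIdeal A) : Type :=
  Quotient.quot (ideal_pred I).

Section QuotAlg.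
Variables (K : fieldType) (A : algType K) (I : properIdeal A).
Local Notation Q := (quotAlg I).

HB.instance Definition _ := GRing.Zmodule.on Q.
HB.instance Definition _ := EqQuotient.on Q.

Definition piQ (x : A) : Q := \pi_Q x.

Fact piQ_eq x y : (piQ x == piQ y) = (x - y \in ideal_pred I).
Proof. by rewrite Quotient.idealrBE. Qed.

Fact piQP x y : x - y \in ideal_pred I -> piQ x = piQ y.
Proof. by rewrite -piQ_eq => /eqP. Qed.

Fact piQ_repr x : piQ (repr x) = x.
Proof. exact: reprK. Qed.

Fact repr_piQ x : repr (piQ x) - x \in ideal_pred I.
Proof. by rewrite -piQ_eq piQ_repr. Qed.

Fact piQD x y : piQ (x + y) = piQ x + piQ y.
Proof. exact: Quotient.pi_add. Qed.

Definition oneQ : Q := piQ 1.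
Definition mulQ (x y : Q) : Q := piQ (repr x * repr y).
Definition scaleQ (c : K) (x : Q) : Q := piQ (c *: repr x).

Fact mulQE x y : mulQ (piQ x) (piQ y) = piQ (x * y).
Proof.
apply: piQP; set x' := repr _; set y' := repr _.
have -> : x' * y' - x * y = (x' - x) * y' + x * (y' - y).
  by rewrite mulrBl mulrBr addrA subrK.
by apply: rpredD; [apply: ideal_predMr|apply: ideal_predMl];
  apply: repr_piQ.
Qed.

Fact scaleQE c x : scaleQ c (piQ x) = piQ (c *: x).
Proof.
apply: piQP; rewrite -scalerBr -mulr_algl.
by apply: ideal_predMl; apply: repr_piQ.
Qed.

Fact mulQA : associative mulQ.
Proof.
move=> x y z; rewrite -[x]piQ_repr -[y]piQ_repr -[z]piQ_repr.
by rewrite !mulQE mulrA.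
Qed.

Fact mul1Q : left_id oneQ mulQ.
Proof. by move=> x; rewrite -[x]piQ_repr mulQE mul1r. Qed.

Fact mulQ1 : right_id oneQ mulQ.
Proof. by move=> x; rewrite -[x]piQ_repr mulQE mulr1. Qed.

Fact mulQDl : left_distributive mulQ +%R.
Proof.
move=> x y z; rewrite -[x]piQ_repr -[y]piQ_repr -[z]piQ_repr.
by rewrite -piQD !mulQE -piQD mulrDl.
Qed.

Fact mulQDr : right_distributive mulQ +%R.
Proof.
move=> x y z; rewrite -[x]piQ_repr -[y]piQ_repr -[z]piQ_repr.
by rewrite -piQD !mulQE -piQD mulrDr.
Qed.

Fact piQ0 : piQ 0 = 0.
Proof. by apply: (addrI (piQ 0)); rewrite -piQD !addr0. Qed.

Fact oneQ_neq0 : oneQ != 0.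
Proof.
rewrite -piQ0 piQ_eq subr0; apply/asboolP; exact: ideal_proper.
Qed.

HB.instance Definition _ := GRing.Zmodule_isNzRing.Build Q
  mulQA mul1Q mulQ1 mulQDl mulQDr oneQ_neq0.

Fact scaleQA c d x : scaleQ c (scaleQ d x) = scaleQ (c * d) x.
Proof. by rewrite -[x]piQ_repr !scaleQE scalerA. Qed.

Fact scale1Q : left_id 1 scaleQ.
Proof. by move=> x; rewrite -[x]piQ_repr scaleQE scale1r. Qed.

Fact scaleQDr : right_distributive scaleQ +%R.
Proof.
move=> c x y; rewrite -[x]piQ_repr -[y]piQ_repr.
by rewrite -piQD !scaleQE -piQD scalerDr.
Qed.

Fact scaleQDl x : {morph scaleQ^~ x : c d / c + d}.
Proof. by move=> c d; rewrite -[x]piQ_repr !scaleQE -piQD scalerDl. Qed.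

HB.instance Definition _ := GRing.Zmodule_isLmodule.Build K Q
  scaleQA scale1Q scaleQDr scaleQDl.

Fact scaleQAl (c : K) (x y : Q) : c *: (x * y) = (c *: x) * y.
Proof.
rewrite -[x]piQ_repr -[y]piQ_repr.
rewrite [LHS](congr1 (scaleQ c) (mulQE _ _)) scaleQE scalerAl.
by rewrite [in RHS](scaleQE c (repr x) : c *: piQ _ = _) [RHS]mulQE.
Qed.

HB.instance Definition _ := GRing.Lmodule_isLalgebra.Build K Q scaleQAl.

Fact scaleQAr (c : K) (x y : Q) : c *: (x * y) = x * (c *: y).
Proof.
rewrite -[x]piQ_repr -[y]piQ_repr.
rewrite [LHS](congr1 (scaleQ c) (mulQE _ _)) scaleQE scalerAr.
by rewrite [in RHS](scaleQE c (repr y) : c *: piQ _ = _) [RHS]mulQE.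
Qed.

HB.instance Definition _ := GRing.Lalgebra_isAlgebra.Build K Q scaleQAr.

End QuotAlg.

(* K<x_1, ..., x_n>, as the subalgebra of K<X> of the elements supported on
   words in the first n letters *)
Definition freeAlgN_pred (K : fieldType) (n : nat) : {pred freeAlg K} :=
  fun f => all (fun m : {fmonom nat} => all (fun i => (i < n)%N) m) (msupp f).

Section FreeAlgN.
Variables (K : fieldType) (n : nat).
Local Notation S := (@freeAlgN_pred K n).

Fact freeAlgN_predP (f : freeAlg K) :
  reflect (forall m : {fmonom nat}, m \in msupp f ->
             {in (m : seq nat), forall i, (i < n)%N})
          (f \in S).
Proof.
by apply: (iffP allP) => fS m /fS => [/allP|mS]; last exact/allP.
Qed.

Fact freeAlgN_subalg_closed : subalg_closed S.
Proof.
split=> [|c f g /freeAlgN_predP fS /freeAlgN_predP gS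
         |f g /freeAlgN_predP fS /freeAlgN_predP gS]; apply/freeAlgN_predP.
- have msupp1 : msupp (1 : freeAlg K) = [fset mone]%fset by exact: msuppU1.
  move=> m; rewrite msupp1.
  by rewrite in_fset1 => /eqP-> i; rewrite fm1.
- move=> m /(fsubsetP (msuppD_le _ _)); rewrite in_fsetU.
  case/orP; last exact: gS.
  by move=> /(fsubsetP (msuppZ_le _ _)); apply: fS.
- move=> m /msuppM_le [m1 [m2 [/fS m1S /gS m2S ->]]] i.
  by rewrite fmM mem_cat => /orP[/m1S|/m2S].
Qed.

HB.instance Definition _ :=
  GRing.isSubalgClosed.Build K (freeAlg K) S freeAlgN_subalg_closed.

Record freeAlgN : predArgType :=
  FreeAlgN { freeAlgN_val :> freeAlg K; _ : freeAlgN_val \in S }.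

HB.instance Definition _ := [isSub for freeAlgN_val].
HB.instance Definition _ := [Choice of freeAlgN by <:].
HB.instance Definition _ := [SubChoice_isSubAlgebra of freeAlgN by <:].

End FreeAlgN.

(* I_q is proper for q >= 2: its elements have no constant term. *)
Section CommIdeal.
Variables (K : fieldType) (n p : nat).

Fact mcoeff1M (f g : freeAlg K) : (f * g)@_mone = f@_mone * g@_mone.
Proof. exact: (rmorphM (@mcoeff {fmonom nat} K mone)). Qed.

Fact lcomm_mcoeff1 (s : seq (freeAlg K)) :
  (1 < size s)%N -> (lcomm s)@_mone = 0.
Proof.
have comm0 (f g : freeAlg K) : (comm f g)@_mone = 0.
  by rewrite /comm mcoeffB !mcoeff1M mulrC subrr.
case: s => // f s; rewrite /lcomm /=; case/lastP: s => // s g _.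
by rewrite -cats1 foldl_cat comm0.
Qed.

Fact comm_ideal_mcoeff1 (f : freeAlg K) :
  (0 < p)%N -> comm_ideal p.+1 f -> f@_mone = 0.
Proof.
move=> p_gt0 /(_ [set g : freeAlg K | g@_mone = 0]); apply.
split=> [|_ [u ->]]; last by apply: lcomm_mcoeff1; rewrite size_tuple.
split=> [|x y /= x0 y0|a x /= x0]; first exact: mcoeff0.
- by rewrite mcoeffB x0 y0 subr0.
- by rewrite !mcoeff1M x0 mulr0 mul0r.
Qed.

Definition relfree_carrier : set (freeAlgN K n) :=
  [set f | comm_ideal p.+1 (val f)].

Fact relfree_carrierP : two_sided_ideal relfree_carrier.
Proof.
have [I0 IB IM] := ideal_gen_ideal
  [set f | exists u : (p.+1).-tuple (freeAlg K), f = lcomm u].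
split=> [|x y|a x]; [exact: I0|exact: IB|exact: (IM (val a))].
Qed.

Fact relfree_proper (p_gt0 : (0 < p)%N) : ~ relfree_carrier 1.
Proof.
move=> /(comm_ideal_mcoeff1 p_gt0) /eqP.
by rewrite (rmorph1 (@mcoeff {fmonom nat} K mone)) oner_eq0.
Qed.

(* I_{p+1} \cap K<x_1, ..., x_n> *)
Definition relfree_ideal (p_gt0 : (0 < p)%N) : properIdeal (freeAlgN K n) :=
  ProperIdeal relfree_carrierP (relfree_proper p_gt0).

(* F_n(N_p) *)
Definition relfree (p_gt0 : (0 < p)%N) : algType K :=
  quotAlg (relfree_ideal p_gt0).

End CommIdeal.

(* Main.v *)
Require Import Defs.
From HB Require Import structures.
From mathcomp Require Import all_boot all_algebra.
From mathcomp Require Import finmap monalg.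
From mathcomp Require Import boolp classical_sets.

(** Write [I_q] for the ideal generated by the commutators of length [q] and
[L_q] for the additive span of these commutators.

The theorem is a pigeonhole argument. A commutator of two elements of
[K<x_1, ..., x_n>] lies in the ideal generated by the [[x_i, x_j]] with
[i <> j], because commutation is a derivation in each argument. Hence a product
of [k/2] commutators is a sum of products in which [k/2] such factors
[[x_i, x_j]] occur, separated by arbitrary elements. These factors carry [k]
letters altogether, and [k > n (p - 1)], so in each of these products some
letter [x_i] occurs in at least [p] of the factors. It then suffices that a
product in which [e] factors of the form [[y, x]] occur, with one and the same
[x] and arbitrary [y], belongs to [I_(e+1)]; for [e = p] this is the ideal that
is zero in the relatively free algebra.

For [e = 2] this follows by applying the derivation [D = [_, x]] twice to a
product: [2 D(y) D(z) = D^2(yz) - y D^2(z) - D^2(y) z] lies in [I_3]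
([lcomm_ideal3_two_comm]). For larger [e], factors are absorbed two at a time
by means of the inclusion [I_q I_3 <= I_(q+2)] ([lcomm_ideal_mul3]). Since
[[l, x] b = [l, x b] - x [l, b]], this inclusion reduces to
[[L_q, I_3] <= L_(q+3)], and by induction on [q] to [[A, I_3] <= L_4].

The last inclusion is the only place that needs a real computation. Modulo
[L_4], the element [F = [[x, y, z] w, c]] is alternating in [x, y], alternating
in [z, w, c], and satisfies the Jacobi identity in [x, y, z]. An abstract
function of five letters with these symmetries satisfies [6 F = 0]
([alternating_jacobi_torsion]), so [F] is in [L_4] when 6 is invertible. *)

Set Implicit Arguments.
Unset Strict Implicit.
Unset Printing Implicit Defensive.

Import GRing.Theory.

Local Open Scope ring_scope.
Local Open Scope quotient_scope.

(** * Commutators *)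

Section CommutatorCalculus.
Variable R : pzRingType.
Implicit Types a b c u w x y z : R.

Lemma commC a b : comm a b = - comm b a.
Proof. by rewrite /comm opprB. Qed.

Lemma commDl a b c : comm (a + b) c = comm a c + comm b c.
Proof. by rewrite /comm mulrDl mulrDr opprD addrACA. Qed.

Lemma commNl a b : comm (- a) b = - comm a b.
Proof. by rewrite /comm mulNr mulrN opprB opprK addrC. Qed.

Lemma commBl a b c : comm (a - b) c = comm a c - comm b c.
Proof. by rewrite commDl commNl. Qed.

Lemma commBr a b c : comm a (b - c) = comm a b - comm a c.
Proof. by rewrite ![comm a _]commC commBl opprB opprK addrC. Qed.

Lemma commMl a b c : comm (a * b) c = a * comm b c + comm a c * b.
Proof. by rewrite /comm mulrBr mulrBl !mulrA addrA subrK. Qed.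

Lemma commMr a b c : comm a (b * c) = comm a b * c + b * comm a c.
Proof.
by rewrite ![comm a _]commC commMl opprD mulrN mulNr addrC.
Qed.

Lemma comm_jacobi x y z :
  comm (comm x y) z + comm (comm y z) x + comm (comm z x) y = 0.
Proof.
have -> : comm (comm x y) z = comm x (comm y z) + comm (comm x z) y.
  by rewrite [comm x y]/comm commBl !commMl opprD [- _ - _]addrC addrACA.
rewrite [comm x (comm y z)]commC [comm z x]commC commNl.
by rewrite addrAC addrK addNr.
Qed.

(** Symmetrized in [z] and [w], the product [[u, z] w] becomes a sum of
commutators that start with [u]. Both exchange relations of
[lie4_lcomm3_mul] come from this. *)
Lemma comm_mul_sym u z w :
  comm u z * w + comm u w * z = comm u (z * w) + comm (comm u w) z.
Proof.
by rewrite commMr [comm (comm u w) z]/comm -addrA [z * _ + _]addrC subrK.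
Qed.

End CommutatorCalculus.

(** * Alternating functions of five letters with a Jacobi identity *)

Section FiveLetters.
Variables (T : Type) (V : zmodType) (F : T -> T -> T -> T -> T -> V).
Hypothesis F_swap12 : forall x y z w c, F y x z w c = - F x y z w c.
Hypothesis F_swap34 : forall x y z w c, F x y w z c = - F x y z w c.
Hypothesis F_swap45 : forall x y z w c, F x y z c w = - F x y z w c.
Hypothesis F_jacobi : forall x y z w c,
  F x y z w c + F y z x w c + F z x y w c = 0.

Let F_rot345 x y z w c : F x y w c z = F x y z w c.
Proof. by rewrite F_swap45 F_swap34 opprK. Qed.

(** Up to the sign of the arrangement of the letters, [F x y z w c] depends only
on the edge [{x, y}] of the complete graph on five vertices, and the Jacobi
identity says that the sum over each triangle is zero. Adding the triangles
[xyz] and [xyw] and subtracting [xzw] and [yzw] leaves twice the difference of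
the opposite edges [xy] and [zw]. *)
Let F_exchange x y z w c : F x y z w c *+ 2 = F z w x y c *+ 2.
Proof.
have E1 := F_jacobi x y z w c; have E2 := F_jacobi x z w y c.
have E3 := F_jacobi y z w x c; have E4 := F_jacobi x y w z c.
rewrite [F x z w y c]F_swap12 [F z x w y c]F_swap34 opprK in E2.
rewrite [F y z w x c]F_swap34 [F z w y x c]F_swap34 in E3.
rewrite [F x y w z c]F_swap34 [F y w x z c]F_swap12 [F w y x z c]F_swap34 in E4.
rewrite opprK [F w x y z c]F_swap34 in E4.
move: E1 E2 E3 E4; set a := F x y z w c; set b := F z w x y c.
set p := F y z x w c; set q := F z x y w c; set r := F w x z y c.
set s := F w y z x c => E1 E2 E3 E4.
have aE' : a = s - r.
  by apply/eqP; rewrite -subr_eq0 -oppr_eq0 opprB -E4 addrC addrA.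
have sE : s = p + b.
  by apply/eqP; rewrite -subr_eq0 -E3 opprD addrC.
have aE : a = - p - q by apply/eqP; rewrite -subr_eq0 -E1 -opprD opprK addrA.
have bE : b = - q - r.
  by apply/eqP; rewrite -subr_eq0 -E2 -opprD opprK [q + r]addrC addrA addrC
    addrA.
rewrite !mulr2n {1}aE aE' sE -[p + b - r]addrA addrACA addNr add0r addrCA.
by rewrite -bE.
Qed.

(** Both adjacent edges [xy] and [xz] are disjoint from the edge [wc], so two
exchanges move one to the other. *)
Let F_rot123 x y z w c : F x y z w c *+ 2 = F z x y w c *+ 2.
Proof.
by rewrite -F_rot345 F_exchange -F_rot345 -F_rot345 F_exchange F_rot345.
Qed.

(** All edges have the same double, and the three edges of a triangle sum to
zero. *)
Lemma alternating_jacobi_torsion x y z w c : F x y z w c *+ 6 = 0.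
Proof.
have rotxyz := F_rot123 x y z w c; have rotzxy := F_rot123 z x y w c.
have thrice (v : V) : v *+ 3 = v + v + v by rewrite mulrSr mulr2n.
rewrite (mulrnA _ 2 3) thrice {2 3}rotxyz {1}rotzxy.
by rewrite -!mulrnDl F_jacobi mul0rn.
Qed.

End FiveLetters.

(** * Ideals and additive spans of long commutators *)

Section TwoSidedIdeals.
Variables (R : pzRingType) (I : set R).
Hypothesis Iideal : two_sided_ideal I.

Lemma ideal0 : I 0. Proof. by case: Iideal. Qed.

Lemma idealB x y : I x -> I y -> I (x - y).
Proof. by case: Iideal => _ IB _; apply: IB. Qed.

Lemma idealN x : I x -> I (- x).
Proof. by rewrite -[- x]add0r; apply: idealB ideal0. Qed.

Lemma idealD x y : I x -> I y -> I (x + y).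
Proof.
by move=> Ix Iy; rewrite -[y]opprK; apply: idealB => //; apply: idealN.
Qed.

Lemma idealMl a x : I x -> I (a * x).
Proof. by case: Iideal => _ _ IM /(IM a) []. Qed.

Lemma idealMr a x : I x -> I (x * a).
Proof. by case: Iideal => _ _ IM /(IM a) []. Qed.

End TwoSidedIdeals.

Definition lcomm_ideal (R : pzRingType) (q : nat) : set R :=
  ideal_gen [set f | exists u : q.-tuple R, f = lcomm u].

Lemma lcomm_idealP (R : pzRingType) q : two_sided_ideal (@lcomm_ideal R q).
Proof. exact: ideal_gen_ideal. Qed.

Lemma lcomm_ideal_lcomm (R : pzRingType) (u : seq R) :
  lcomm_ideal (size u) (lcomm u).
Proof. by move=> I [_]; apply; exists (in_tuple u). Qed.

Lemma lcomm_ideal_min (R : pzRingType) q (I : set R) :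
    two_sided_ideal I -> (forall u : seq R, size u = q -> I (lcomm u)) ->
  forall a, lcomm_ideal q a -> I a.
Proof.
by move=> Iideal Ilcomm a; apply; split=> // _ [u ->]; apply/Ilcomm/size_tuple.
Qed.

Lemma lcomm_rcons (R : pzRingType) (u : seq R) a :
  (0 < size u)%N -> lcomm (rcons u a) = comm (lcomm u) a.
Proof. by case: u => // b u _; rewrite /lcomm /= -cats1 foldl_cat. Qed.

(** The span is additive only: it is already closed under scalars, which can be
moved into the first entry of a commutator when [q] is positive, see
[lie_powerZ]. *)
Inductive lie_span (R : pzRingType) (q : nat) : R -> Prop :=
| lie_span_lcomm u : size u = q -> lie_span q (lcomm u)
| lie_spanB a b : lie_span q a -> lie_span q b -> lie_span q (a - b).

Definition lie_power (R : pzRingType) (q : nat) : {pred R} :=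
  fun a => `[< lie_span q a >].

Section LiePowerZmod.
Variables (R : pzRingType) (q : nat).

Fact lie_power_zmod_closed : zmod_closed (@lie_power R q).
Proof.
split=> [|a b /asboolP La /asboolP Lb]; apply/asboolP; last exact: lie_spanB.
have L0 : lie_span q (lcomm (nseq q (0 : R))).
  by apply: lie_span_lcomm; rewrite size_nseq.
by rewrite -(subrr (lcomm (nseq q 0))); apply: lie_spanB.
Qed.

HB.instance Definition _ :=
  GRing.isZmodClosed.Build R (@lie_power R q) lie_power_zmod_closed.

End LiePowerZmod.

Section LiePower.
Variable R : pzRingType.

Lemma lie_power_ind q (P : R -> Prop) :
    (forall u, size u = q -> P (lcomm u)) ->
    (forall a b, P a -> P b -> P (a - b)) ->
  forall a, a \in lie_power q -> P a.
Proof.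
move=> Plcomm PB a /asboolP; elim=> [u|b c _ Pb _ Pc]; [exact: Plcomm|exact: PB].
Qed.

Lemma lie_power_lcomm (u : seq R) : lcomm u \in lie_power (size u).
Proof. by apply/asboolP/lie_span_lcomm. Qed.

Lemma lie_power_comm q (a b : R) :
  a \in lie_power q.+1 -> comm a b \in lie_power q.+2.
Proof.
move: a; apply: lie_power_ind => [u su|a c La Lc].
  by rewrite -lcomm_rcons ?su // -su -(size_rcons u b) lie_power_lcomm.
by rewrite commBl rpredB.
Qed.

Lemma lie_power_ideal q (a : R) : a \in lie_power q -> lcomm_ideal q a.
Proof.
move: a; apply: lie_power_ind => [u <-|a b]; first exact: lcomm_ideal_lcomm.
exact: (idealB (lcomm_idealP R q)).
Qed.

End LiePower.

Lemma lie_powerZ (K : fieldType) (A : algType K) q (c : K) (a : A) :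
  a \in lie_power q.+1 -> c *: a \in lie_power q.+1.
Proof.
have commZl (x y : A) : c *: comm x y = comm (c *: x) y.
  by rewrite /comm scalerBr scalerAl scalerAr.
elim: q a => [|q IHq]; apply: lie_power_ind => [u|a b La Lb];
  rewrite ?scalerBr ?rpredB //.
- by case: u => [|x []] //= _; exact: (lie_power_lcomm [:: c *: x]).
- case/lastP: u => // u x; rewrite size_rcons => -[su].
  rewrite lcomm_rcons ?su // commZl lie_power_comm //; apply: IHq.
  by rewrite -su lie_power_lcomm.
Qed.

(** The Jacobi identity, with the sum of two commutators whose outer entries
are [y] and [z]: this form drives inductions on the length of an entry. *)
Lemma comm_comm (R : pzRingType) (x y z : R) :
  comm x (comm y z) = comm (comm x y) z - comm (comm x z) y.
Proof.
apply/eqP; rewrite -subr_eq0 -oppr_eq0 -(comm_jacobi x y z).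
rewrite [comm x (comm y z)]commC [comm z x]commC commNl.
by rewrite -opprD opprK addrCA addrA.
Qed.

Lemma lie_power_comm_lie i j (R : pzRingType) (a b : R) :
  a \in lie_power i.+1 -> b \in lie_power j.+1 ->
  comm a b \in lie_power (i + j).+2.
Proof.
move=> + Lb; elim: j i a b Lb => [|j IHj] i a b Lb La.
  by rewrite addn0 lie_power_comm.
move: b Lb; apply: lie_power_ind => [|b b' Lb Lb']; last by rewrite commBr rpredB.
case/lastP=> // u x; rewrite size_rcons => -[su]; rewrite lcomm_rcons ?su //.
have Lu : lcomm u \in lie_power j.+1 by rewrite -su lie_power_lcomm.
rewrite comm_comm addnS rpredB //; first by rewrite lie_power_comm ?IHj.
by rewrite -addSn IHj ?lie_power_comm.
Qed.

(** Congruences modulo an additive subgroup become equations between values of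
an additive map. *)
Lemma zmodClosed_kernel (V : zmodType) (L : zmodClosed V) :
  exists (Q : zmodType) (f : {additive V -> Q}), forall a, f a = 0 <-> a \in L.
Proof.
exists (Quotient.quot L), \pi_(Quotient.quot L) => a.
by rewrite -[X in X \in L]subr0 Quotient.idealrBE raddf0; split=> /eqP.
Qed.

(** * Products with the ideal of the commutators of length three *)

Section LieNilpotency.
Variables (K : fieldType) (A : algType K).
Hypothesis charK0 : [pchar K] =i pred0.
Implicit Types a b c l u v w x y z : A.

Lemma lie_power_divn n a :
  (0 < n)%N -> a *+ n \in lie_power 4 -> a \in lie_power 4.
Proof.
move=> n_gt0 La.
have n_neq0 : n%:R != 0 :> K by rewrite ((pcharf0P K).1 charK0) -lt0n.
rewrite -[a]scale1r -(mulVf n_neq0) -scalerA scaler_nat.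
exact: lie_powerZ.
Qed.

(** Modulo [L_4], the relation [[u, z w] = [u, z] w + z [u, w]] with
[u = [x, y]] gives the sign rule for exchanging [z] and [w], and the derivation
rule in [[l w, c]] with [l = [x, y, z]] gives the one for [w] and [c]. *)
Lemma lie4_lcomm3_mul x y z w c :
  comm (comm (comm x y) z * w) c \in lie_power 4.
Proof.
have [Q [f kerf]] := zmodClosed_kernel (@lie_power A 4).
have skew a b : a + b \in lie_power 4 -> f a = - f b.
  by move/kerf; rewrite raddfD => /eqP; rewrite addr_eq0 => /eqP.
have L4comm a b d e : comm (comm (comm a b) d) e \in lie_power 4.
  exact: (lie_power_lcomm [:: a; b; d; e]).
apply: (@lie_power_divn 6) => //; apply/kerf; rewrite raddfMn.
pose F x y z w c := f (comm (comm (comm x y) z * w) c).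
apply: (@alternating_jacobi_torsion _ _ F) => {}x {}y {}z {}w {}c; rewrite /F.
- by rewrite [comm y x]commC commNl mulNr commNl raddfN.
- by apply: skew; rewrite -commDl comm_mul_sym commDl rpredD ?L4comm.
- set l := comm (comm x y) z; apply: skew.
  rewrite !commMl [comm c w]commC mulrN [- _ + _]addrC -addrA addKr.
  by rewrite comm_mul_sym rpredD ?L4comm.
- rewrite -!raddfD -!commDl -!mulrDl comm_jacobi.
  by rewrite mul0r /comm mul0r mulr0 subrr raddf0.
Qed.

Lemma lie4_comm_ideal3 a c : lcomm_ideal 3 a -> comm a c \in lie_power 4.
Proof.
pose I :=
  [set a : A | forall u v d, comm (u * a * v) d \in lie_power 4]%classic.
suff Isub : forall a, lcomm_ideal 3 a -> I a.
  by move=> /Isub /(_ 1 1 c); rewrite mul1r mulr1.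
apply: lcomm_ideal_min => [|[|x [|y [|z []]]] //= _ u v d].
  split=> [u v d|x y Ix Iy u v d|b x Ix].
  - by rewrite mulr0 mul0r /comm mul0r mulr0 subrr rpred0.
  - by rewrite mulrBr mulrBl commBl rpredB ?Ix ?Iy.
  - by split=> u v d; rewrite !mulrA -?[u * x * b * v]mulrA Ix.
(* u [x,y,z] = [x,y,z] u - [x,y,z,u], and the commutator [x,y,z,u] is of the
   form [x',y',z'] with x' = [x,y] *)
rewrite /lcomm /=; set l := comm (comm x y) z.
have -> : u * l = l * u - comm l u by rewrite /comm opprB addrC subrK.
by rewrite mulrBl commBl -mulrA rpredB ?lie4_lcomm3_mul.
Qed.

(** Induction on [q] from [lie4_comm_ideal3], using
[[[l, x], a] = [[l, a], x] + [l, [x, a]]], where [[x, a]] is in [L_4] by the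
base case and [lie_power_comm_lie] bounds its commutator with [l]. *)
Lemma lie_power_comm_ideal3 q l a :
  l \in lie_power q.+1 -> lcomm_ideal 3 a -> comm l a \in lie_power q.+4.
Proof.
move=> + Ma; move: l; elim: q => [|q IHq] l.
  by move=> _; rewrite commC rpredN lie4_comm_ideal3.
move: l; apply: lie_power_ind => [|l l' Ll Ll']; last by rewrite commBl rpredB.
case/lastP=> // u x; rewrite size_rcons => -[su]; rewrite lcomm_rcons ?su //.
set l := lcomm u; have Ll : l \in lie_power q.+1 by rewrite -su lie_power_lcomm.
rewrite -[comm (comm l x) a](subrK (comm (comm l a) x)) -comm_comm.
rewrite addrC rpredD //; first by rewrite lie_power_comm ?IHq.
have L4 : comm x a \in lie_power 4 by rewrite commC rpredN lie4_comm_ideal3.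
by have := lie_power_comm_lie Ll L4; rewrite addn3.
Qed.

(** In general the product of two of these ideals satisfies only
[I_p I_q <= I_(p+q-2)]; the gain of one here is what makes the count of letters
in the main argument exact. *)
Lemma lcomm_ideal_mul3 q a b :
  lcomm_ideal q.+1 a -> lcomm_ideal 3 b -> lcomm_ideal q.+3 (a * b).
Proof.
have Mideal n := lcomm_idealP A n.
case: q => [|q] => [_|Ma]; first exact: (idealMl (Mideal 3)).
pose I :=
  [set a : A | forall b, lcomm_ideal 3 b -> lcomm_ideal q.+4 (a * b)]%classic.
suff Isub : forall a, lcomm_ideal q.+2 a -> I a by apply: Isub.
apply: lcomm_ideal_min => [|u].
  split=> [b' Mb'|x y Ix Iy b' Mb'|d x Ix].
  - by rewrite mul0r; apply: (ideal0 (Mideal _)).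
  - by rewrite mulrBl; apply: (idealB (Mideal _)); [apply: Ix|apply: Iy].
  - split=> b' Mb'; rewrite -mulrA.
      by apply: (idealMl (Mideal _)); apply: Ix.
    by apply: Ix; apply: (idealMl (Mideal 3)).
case/lastP: u => // u x; rewrite size_rcons => -[su] b' Mb'.
rewrite lcomm_rcons ?su //; set l := lcomm u.
have Ll : l \in lie_power q.+1 by rewrite -su lie_power_lcomm.
(* [l,x] b = [l,xb] - x [l,b] *)
rewrite -[comm l x * b'](addrK (x * comm l b')) -commMr.
apply: (idealB (Mideal q.+4)).
  apply: lie_power_ideal; apply: lie_power_comm_ideal3 => //.
  exact: (idealMl (Mideal 3)).
apply: (idealMl (Mideal q.+4)).
by apply: lie_power_ideal; apply: lie_power_comm_ideal3.
Qed.

(** The middle factor is removed with [D(y) u = D(y u) - y D(u)]; then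
[2 D(y) D(z)] is read off from the second derivative of a product. *)
Lemma lcomm_ideal3_two_comm x u y z :
  lcomm_ideal 3 (comm y x * u * comm z x).
Proof.
have M3 := lcomm_idealP A 3.
have M3sq a : lcomm_ideal 3 (comm (comm a x) x).
  exact: (@lcomm_ideal_lcomm A [:: a; x; x]).
suff M3two a b : lcomm_ideal 3 (comm a x * comm b x).
  rewrite -[comm y x * u](addKr (y * comm u x)) -commMl mulrDl addrC mulNr -mulrA.
  by apply: (idealB M3) => //; apply: (idealMl M3).
have n2_neq0 : 2%:R != 0 :> K by rewrite ((pcharf0P K).1 charK0).
rewrite -[X in lcomm_ideal 3 X]scale1r -(mulVf n2_neq0) -scalerA scaler_nat.
rewrite -mulr_algl; apply: (idealMl M3).
have -> : comm a x * comm b x *+ 2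
    = comm (comm (a * b) x) x - a * comm (comm b x) x - comm (comm a x) x * b.
  rewrite commMl commDl !commMl [_ + (_ + _)]addrA [RHS]addrAC addrK [RHS]addrC.
  by rewrite -[_ + _ + _]addrA addKr mulr2n.
apply: (idealB M3); last exact: (idealMr M3).
by apply: (idealB M3) => //; apply: (idealMl M3).
Qed.

(** [absorbs x e a] abstracts from a product [a] in which [e] factors [[y, x]]
occur. The second clause anticipates the next such factor: factors are
absorbed in pairs, so membership of [a] in [I_(e+1)] alone would not be
inherited when one factor is appended. *)
Definition absorbs x e a :=
  lcomm_ideal e.+1 a /\ forall u y, lcomm_ideal e.+2 (a * u * comm y x).

Lemma absorbs0 x a : absorbs x 0 a.
Proof.
split=> [|u y]; first exact: (@lcomm_ideal_lcomm A [:: a]).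
apply: (idealMl (lcomm_idealP A 2)).
exact: (@lcomm_ideal_lcomm A [:: y; x]).
Qed.

Lemma absorbs_mulr x e a u : absorbs x e a -> absorbs x e (a * u).
Proof.
case=> Ma Mac; split=> [|v y]; last by rewrite -(mulrA a).
exact: (idealMr (lcomm_idealP A e.+1)).
Qed.

(** The first clause is the second clause of the hypothesis; the second one
holds because two consecutive factors form an element of [I_3]. *)
Lemma absorbs_comm x e a u y :
  absorbs x e a -> absorbs x e.+1 (a * u * comm y x).
Proof.
case=> Ma Mac; split=> [//|v z].
rewrite -!(mulrA a); apply: lcomm_ideal_mul3 => //.
rewrite -!(mulrA u) mulrA -mulrA; apply: (idealMl (lcomm_idealP A 3)).
exact: lcomm_ideal3_two_comm.
Qed.

Lemma lcomm_ideal_anti p q a :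
  (0 < p)%N -> (p <= q)%N -> lcomm_ideal q a -> lcomm_ideal p a.
Proof.
move=> p_gt0; elim: q => [|q IHq]; first by case: p p_gt0.
rewrite leq_eqVlt ltnS => /predU1P[<- //|le_pq] Ma; apply: IHq => //.
have Mq := lcomm_idealP A q.
move: a Ma; apply: lcomm_ideal_min => //; case/lastP=> // u x.
rewrite size_rcons => -[su]; rewrite lcomm_rcons ?su ?(leq_trans p_gt0) //.
have Mu : lcomm_ideal q (lcomm u) by rewrite -su; apply: lcomm_ideal_lcomm.
by apply: (idealB Mq); [apply: (idealMr Mq)|apply: (idealMl Mq)].
Qed.

(** If all [d i] were at most [p - 1], their sum would be at most
[n (p - 1)]. *)
Lemma absorbs_sum_ideal (X : nat -> A) n p (d : nat -> nat) a :
    (0 < p)%N -> (forall i, (i < n)%N -> absorbs (X i) (d i) a) ->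
    (n * p.-1 < \sum_(i < n) d i)%N ->
  lcomm_ideal p.+1 a.
Proof.
move=> p_gt0 aX lt_np.
have [i le_pd] : exists i : 'I_n, (p <= d i)%N.
  apply/existsP; rewrite -[[exists _, _]]negbK negb_exists.
  apply/negP => /forallP dp.
  move: lt_np; rewrite ltnNge => /negP; apply.
  rewrite -[X in (_ <= X * _)%N]card_ord -sum_nat_const; apply: leq_sum => i _.
  by rewrite -ltnS prednK // ltnNge.
have [Ma _] := aX i (ltn_ord i).
exact: lcomm_ideal_anti Ma.
Qed.

(** Here [d i] counts the factors of [a] that contain the letter [X i]. In the
induction on [cs], the first element of [cs] is replaced with
[u [X i, X j] v], which moves it into [a] and raises the total count by
two. *)
Lemma prod_comm_ideal (X : nat -> A) n p (cs : seq A) (d : nat -> nat) a :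
    (0 < p)%N -> (forall i, (i < n)%N -> absorbs (X i) (d i) a) ->
    (n * p.-1 < \sum_(i < n) d i + (size cs).*2)%N ->
    {in cs, forall c,
      ideal_gen [set f | exists2 i, (i < n)%N &
                         exists2 j, (j < n)%N & f = comm (X i) (X j)]%classic c} ->
  lcomm_ideal p.+1 (a * \prod_(c <- cs) c).
Proof.
move=> p_gt0; have M := lcomm_idealP A p.+1.
elim: cs d a => [|c cs IHcs] d a aX lt_np Ics.
  rewrite big_nil mulr1; apply: absorbs_sum_ideal aX _ => //.
  by rewrite addn0 in lt_np.
set rest := \prod_(c <- cs) c.
pose I :=
  [set g : A | forall u v, lcomm_ideal p.+1 (a * (u * g * v) * rest)]%classic.
suff /(_ 1 1) : I c by rewrite big_cons mul1r mulr1 mulrA.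
apply: (Ics c (mem_head _ _)); split.
  split=> [u v|x y Ix Iy u v|b x Ix].
  - by rewrite mulr0 mul0r mulr0 mul0r; apply: (ideal0 M).
  - rewrite mulrBr mulrBl mulrBr mulrBl.
    by apply: (idealB M); [apply: Ix|apply: Iy].
  - split=> u v; rewrite [u * _]mulrA; first exact: Ix.
    by rewrite -(mulrA (u * x)); apply: Ix.
move=> _ [i lt_in [j lt_jn ->]] u v.
have [<-|neq_ij] := eqVneq i j.
  by rewrite /comm subrr mulr0 mul0r mulr0 mul0r; apply: (ideal0 M).
(* [X j] occurs in [[X i, X j]] as it stands, [X i] after rewriting the factor
   as [[- X j, X i]]. *)
apply: (IHcs (fun k => d k + (k == i) + (k == j))%N) => [k lt_kn||f f_cs].
- rewrite !mulrA; apply: absorbs_mulr.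
  have [->|neq_ki] := eqVneq k i.
    rewrite (negbTE neq_ij) addn0 addn1 commC -commNl.
    exact/absorbs_comm/aX.
  have [->|neq_kj] := eqVneq k j.
    by rewrite addn0 addn1; apply/absorbs_comm/aX.
  by rewrite !addn0 -mulrA; apply/absorbs_mulr/aX.
- rewrite !big_split /= -!addnA; move: lt_np; rewrite /= doubleS => lt_np.
  have one (l : nat) : (l < n)%N -> (\sum_(k < n) (k == l :> nat) = 1)%N.
    move=> lt_ln; rewrite (bigD1 (Ordinal lt_ln)) //= eqxx big1 // => k.
    by rewrite -val_eqE /= => /negbTE ->.
  by rewrite !one.
- by apply: Ics; rewrite inE f_cs orbT.
Qed.

End LieNilpotency.

(** * The free algebra and its evaluations *)

Lemma ideal_comm_sum (R : pzRingType) (I : set R) (J : eqType) (s : seq J)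
    (F : J -> R) c :
    two_sided_ideal I -> {in s, forall j, I (comm (F j) c)} ->
  I (comm (\sum_(j <- s) F j) c).
Proof.
move=> Iideal; elim: s => [|j s IHs] IF.
  by rewrite big_nil /comm mul0r mulr0 subrr; apply: ideal0.
rewrite big_cons commDl; apply: idealD; [by []|exact/IF/mem_head|].
by apply: IHs => i si; apply: IF; rewrite inE si orbT.
Qed.

Lemma ideal_commZ (K : fieldType) (A : algType K) (I : set A)
    (k : K) (a c : A) :
  two_sided_ideal I -> I (comm a c) -> I (comm (k *: a) c).
Proof.
move=> Iideal Iac; rewrite /comm -scalerAl -scalerAr -scalerBr -mulr_algl.
exact: idealMl.
Qed.

Section FreeAlgebra.
Variable K : fieldType.

Lemma freeAlg_monomial (m : {fmonom nat}) :
  << m >> = \prod_(i <- (m : seq nat)) fvar K i :> freeAlg K.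
Proof.
case: m => s; rewrite /=.
elim: s => [|i s IHs]; first by rewrite big_nil /= -fmoneE.
rewrite big_cons -IHs /fvar.
have -> : FMonom (i :: s) = mmul (fmu i) (FMonom s).
  by apply/eqP; rewrite fmP fmM fmU.
by rewrite malgM_def /= fgmulUU mulr1.
Qed.

Lemma freeAlg_sum_words (f : freeAlg K) :
  f = \sum_(m <- msupp f) f@_m *: \prod_(i <- (m : seq nat)) fvar K i.
Proof.
rewrite {1}[f]monalgE; apply: eq_bigr => m _; rewrite -freeAlg_monomial.
by apply/malgP => m'; rewrite mcoeffZ !mcoeffU mulr_natr.
Qed.

(** For a two-sided ideal [I], the elements that commute with [c] modulo [I]
form a subalgebra. *)
Lemma freeAlgN_comm_letters (I : set (freeAlg K)) n (c f : freeAlg K) :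
    two_sided_ideal I -> (forall i, (i < n)%N -> I (comm (fvar K i) c)) ->
  f \in @freeAlgN_pred K n -> I (comm f c).
Proof.
move=> Iideal Ic /freeAlgN_predP fS.
rewrite [f]freeAlg_sum_words; apply: ideal_comm_sum => // m /fS ltmn.
apply: ideal_commZ => //.
elim: (m : seq nat) ltmn => [|i s IHs] ltsn.
  by rewrite big_nil /comm mul1r mulr1 subrr; apply: ideal0.
rewrite big_cons commMl; apply: idealD => //.
  by apply: idealMl => //; apply: IHs => j sj; rewrite ltsn // inE sj orbT.
by apply: idealMr => //; apply/Ic/ltsn/mem_head.
Qed.

Lemma freeAlgN_comm (I : set (freeAlg K)) n (f g : freeAlg K) :
    two_sided_ideal I ->
    (forall i j, (i < n)%N -> (j < n)%N -> I (comm (fvar K i) (fvar K j))) ->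
  f \in @freeAlgN_pred K n -> g \in @freeAlgN_pred K n -> I (comm f g).
Proof.
move=> Iideal Ivar fS gS; apply: freeAlgN_comm_letters fS => // i lt_in.
rewrite commC; apply: idealN => //.
by apply: freeAlgN_comm_letters gS => // j lt_jn; apply: Ivar.
Qed.

Section Evaluation.
Variables (A : algType K) (a : nat -> A).

Definition monomial_eval (m : {fmonom nat}) : A :=
  \prod_(i <- (m : seq nat)) a i.

Fact monomial_eval_mmorphism : mmorphism monomial_eval.
Proof.
split=> [m1 m2|]; rewrite /monomial_eval; first by rewrite fmM big_cat.
by rewrite fm1 big_nil.
Qed.

HB.instance Definition _ :=
  isMultiplicative.Build {fmonom nat} A monomial_eval monomial_eval_mmorphism.

Lemma feval_mmap f : feval a f = mmap (in_alg A) monomial_eval f.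
Proof. by apply: eq_bigr => m _; rewrite mulr_algl. Qed.

Lemma feval_fvar i : feval a (fvar K i) = a i.
Proof.
by rewrite feval_mmap mmapU /= scale1r mul1r /monomial_eval fmU big_seq1.
Qed.

Lemma fevalB f g : feval a (f - g) = feval a f - feval a g.
Proof. by rewrite !feval_mmap raddfB. Qed.

Lemma feval1 : feval a 1 = 1.
Proof. by rewrite feval_mmap mmap1. Qed.

Lemma fevalM f g : feval a (f * g) = feval a f * feval a g.
Proof.
rewrite !feval_mmap; apply: (commr_mmap_is_multiplicative _).1 => h m m'.
by rewrite /GRing.comm mulr_algl mulr_algr.
Qed.

Lemma feval_comm f g : feval a (comm f g) = comm (feval a f) (feval a g).
Proof. by rewrite /comm fevalB 2!fevalM. Qed.

Lemma feval_prod_comm r :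
  feval a (\prod_(i < r) comm (fvar K i.*2) (fvar K i.*2.+1)) =
  \prod_(i < r) comm (a i.*2) (a i.*2.+1).
Proof.
rewrite (big_morph _ fevalM feval1); apply: eq_bigr => i _.
by rewrite feval_comm !feval_fvar.
Qed.

End Evaluation.
End FreeAlgebra.

Lemma piQ_prod_comm (K : fieldType) (A : algType K) (I : properIdeal A)
    (b : nat -> A) r :
  \prod_(i < r) comm (piQ I (b i.*2)) (piQ I (b i.*2.+1)) =
  piQ I (\prod_(i < r) comm (b i.*2) (b i.*2.+1)).
Proof.
have piM : {morph piQ I : x y / x * y} by move=> x y; rewrite -mulQE.
have piN x : piQ I (- x) = - piQ I x.
  by apply/eqP; rewrite -addr_eq0 -piQD addNr piQ0.
rewrite (big_morph _ piM (erefl : piQ I 1 = 1)); apply: eq_bigr => i _.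
by rewrite /comm piQD piN !piM.
Qed.

Theorem proposition5p2 (K : fieldType) (charK0 : [pchar K] =i pred0)
    (n p k : nat) (n_gt0 : (0 < n)%N) (p_gt0 : (0 < p)%N)
    (k_ge : (n * p - n + 1 <= k)%N) (k_even : ~~ odd k) :
  satisfies_identity (relfree K n p_gt0)
    (\prod_(i < k./2) comm (fvar K i.*2) (fvar K i.*2.+1)).
Proof.
move=> a; rewrite feval_prod_comm.
pose b i : freeAlgN K n := repr (a i).
have aE i : a i = piQ _ (b i) by rewrite piQ_repr.
under eq_bigr => i _ do rewrite !aE.
rewrite piQ_prod_comm -(piQ0 (relfree_ideal K n p_gt0)).
apply: piQP; rewrite subr0; apply/asboolP.
pose v : {rmorphism freeAlgN K n -> freeAlg K} := val.
change (comm_ideal p.+1 (v (\prod_(i < k./2) comm (b i.*2) (b i.*2.+1)))).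
rewrite rmorph_prod.
pose c i : freeAlg K := comm (v (b i.*2)) (v (b i.*2.+1)).
have -> : \prod_(i < k./2) v (comm (b i.*2) (b i.*2.+1)) =
          1 * \prod_(f <- [seq c i | i <- index_iota 0 k./2]) f.
  rewrite mul1r big_map big_mkord.
  by apply: eq_bigr => i _; rewrite /comm rmorphB !rmorphM.
apply: (@prod_comm_ideal K (freeAlg K) charK0 (fvar K) n p _ (fun=> 0%N)) => //.
- by move=> i _; apply: absorbs0.
- rewrite size_map size_iota subn0 even_halfK // big1 // add0n.
  by rewrite -subn1 mulnBr muln1 -addn1.
move=> _ /mapP[i _ ->]; apply: (@freeAlgN_comm _ _ n); try exact: valP.
  exact: ideal_gen_ideal.
move=> i1 i2 lt1 lt2 I [_]; apply.
by exists i1 => //; exists i2.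
Qed.
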